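(* Let $L$ be a complete and completely distributive lattice, $G$ a group, $\mu$ an $L$-subgroup of $G$, and let $\eta$ be a maximal $L$-subgroup of $\mu$. Then $\eta$ is a pronormal $L$-subgroup of $\mu$.
   Context: $L$ has least element $0$ and greatest element $1$. An $L$-subset of $G$ is a function $G \to L$; inclusion $\eta\subseteq\mu$ means $\eta(x)\le\mu(x)$ for all $x\in G$; unions and intersections of $L$-subsets are pointwise joins and meets. An $L$-subgroup of $G$ is a function $\mu: G\to L$ with $\mu(xy)\ge\mu(x)\wedge\mu(y)$ and $\mu(x^{-1})=\mu(x)$ for all $x,y\in G$; $L(G)$ is the set of these. For $\mu\in L(G)$, $L(\mu)$ denotes the set of $\eta\in L(G)$ with $\eta\subseteq\mu$ (the $L$-subgroups of $\mu$). For an $L$-subset $\theta$ of $G$, $\langle\theta\rangle$ is the smallest $L$-subgroup of $G$ containing $\theta$, and $\langle\eta,\nu\rangle=\langle\eta\cup\nu\rangle$. $L$-points: for $a\in L$, $x\in G$, the $L$-point $a_x$ is the $L$-subset with value $a$ at $x$ and $0$ elsewhere; $a_x\in\mu$ means $\mu(x)\ge a$. Conjugate: for $\eta\in L(\mu)$ and $a_z\in\mu$, $\eta^{a_z}$ is the $L$-subgroup of $\mu$ given by $\eta^{a_z}(x)=a\wedge\eta(zxz^{-1})$ for all $x\in G$. Pronormal: $\eta\in L(\mu)$ is a pronormal $L$-subgroup of $\mu$ if for every $L$-point $a_x\in\mu$ there exists an $L$-point $b_y\in\langle\eta,\eta^{a_x}\rangle$ such that $\eta^{b_y}=\eta^{a_x}$.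 Maximal: $\eta\in L(\mu)$ is proper if $\eta$ is non-constant and $\eta\ne\mu$. A proper $L$-subgroup $\eta$ of $\mu$ is a maximal $L$-subgroup of $\mu$ if, whenever $\eta\subseteq\theta\subseteq\mu$ with $\theta\in L(\mu)$, either $\theta=\eta$ or $\theta=\mu$. *)

(* Defs.v *)
From HB Require Import structures.
From mathcomp Require Import all_boot all_order all_fingroup.
From mathcomp Require Import boolp classical_sets.

Set Implicit Arguments.
Unset Strict Implicit.
Unset Printing Implicit Defensive.

Import Order.TTheory.

Local Open Scope classical_set_scope.
Local Open Scope order_scope.

(* The defaults \bot and \top are the values on the empty set. In a complete
   lattice Lsup and Linf are the actual suprema and infima (LsupP, LinfP). *)
Definition Lsup d (L : tbLatticeType d) (A : set L) : L := supremum \bot A.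
Definition Linf d (L : tbLatticeType d) (A : set L) : L := infimum \top A.

Definition complete_lattice d (L : tbLatticeType d) : Prop :=
  forall A : set L, (supremums A !=set0)%classic /\ (infimums A !=set0)%classic.

Definition completely_distributive d (L : tbLatticeType d) : Prop :=
  forall (I : Type) (J : I -> set L),
    Linf (range (fun i => Lsup (J i))) =
    Lsup [set Linf (range f) | f in [set f : I -> L | forall i, J i (f i)]].

Section LSubgroups.
Variables (d : Order.disp_t) (L : tbLatticeType d) (G : groupType).

(* L-subsets of G are functions G -> L. Their inclusion and union are the
   pointwise order and join on functions provided by boolp, see lefP, joinfE. *)
Implicit Types (theta eta nu mu : G -> L) (a b : L) (x y z : G).

Definition Lsubgroup mu : Prop :=
  (forall x y, mu x `&` mu y <= mu (x * y)%g) /\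
  (forall x, mu (x^-1)%g = mu x).

Definition Lsubgroup_of mu eta : Prop := Lsubgroup eta /\ eta <= mu.

(* The intersection of all L-subgroups containing theta; it is the smallest
   one when L is complete (see Lgen_sub, Lgen_Lsubgroup, Lgen_min). *)
Definition Lgen theta : G -> L :=
  fun x => Linf [set nu x | nu in [set nu | Lsubgroup nu /\ theta <= nu]].

Definition Lpoint a x : G -> L := fun z => if z == x then a else \bot.

(* Membership of an L-point, indexed by its value a and support x; it agrees
   with inclusion of L-subsets (Lpoint_le). *)
Definition Lpoint_in a x mu : Prop := a <= mu x.

Definition Lconj eta a z : G -> L := fun x => a `&` eta (z * x * z^-1)%g.

Definition pronormal mu eta : Prop :=
  Lsubgroup_of mu eta /\
  forall a x, Lpoint_in a x mu ->
    exists b y, Lpoint_in b y (Lgen (eta `|` Lconj eta a x)) /\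
      Lconj eta b y = Lconj eta a x.

Definition proper_Lsubgroup mu eta : Prop :=
  [/\ Lsubgroup_of mu eta, ~ (exists c, forall x, eta x = c) & eta <> mu].

Definition maximal_Lsubgroup mu eta : Prop :=
  proper_Lsubgroup mu eta /\
  forall theta, Lsubgroup_of mu theta -> eta <= theta ->
    theta = eta \/ theta = mu.

Lemma Lpoint_le a x mu : Lpoint a x <= mu <-> Lpoint_in a x mu.
Proof.
rewrite /Lpoint_in; split=> [/lefP/(_ x)|le_a]; first by rewrite /Lpoint eqxx.
by apply/lefP => z; rewrite /Lpoint; case: eqP => [->|_] //; exact: le0x.
Qed.

Lemma Lconj_Lsubgroup_of mu eta a z : Lsubgroup mu -> Lsubgroup_of mu eta ->
  Lpoint_in a z mu -> Lsubgroup_of mu (Lconj eta a z).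
Proof.
move=> [muM muV] [[etaM etaV] /lefP le_eta] a_mu; split; first split.
- move=> x y; rewrite /Lconj.
  have -> : (z * (x * y) * z^-1 = (z * x * z^-1) * (z * y * z^-1))%g.
    by rewrite !mulgA mulgVK.
  by rewrite meetACA meetxx; apply: leI2 => //; exact: etaM.
- move=> x; rewrite /Lconj -[in RHS]etaV.
  by rewrite !invgM invgK mulgA.
apply/lefP => x; rewrite /Lconj.
have -> : mu x = mu (z^-1 * (z * x * z^-1) * z)%g.
  by rewrite !mulgA mulVg mul1g mulgVK.
apply: le_trans (muM _ _); rewrite lexI (leIxl _ a_mu) andbT.
by apply: le_trans (muM _ _); rewrite lexI muV (leIxl _ a_mu) leIxr // le_eta.
Qed.

Section Complete.
Hypothesis cL : complete_lattice L.

Lemma LsupP (A : set L) : supremums A (Lsup A).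
Proof.
have [[s sA] _] := cL A; rewrite /Lsup /supremum.
case: ifPn => [/eqP ->|_]; last by case: xgetP => // /(_ s).
by split=> // x _; exact: le0x.
Qed.

Lemma LinfP (A : set L) : infimums A (Linf A).
Proof.
have [_ [s sA]] := cL A; rewrite /Linf /infimum.
case: ifPn => [/eqP ->|_]; last by case: xgetP => // /(_ s).
by split=> // x _; exact: lex1.
Qed.

Lemma Lgen_sub theta : theta <= Lgen theta.
Proof.
apply/lefP => x; apply: (LinfP _).2 => _ [nu [_ /lefP le_nu] <-].
exact: le_nu.
Qed.

Lemma Lgen_min theta nu : Lsubgroup nu -> theta <= nu -> Lgen theta <= nu.
Proof. by move=> nuS le_nu; apply/lefP => x; apply: (LinfP _).1; exists nu. Qed.

Lemma Lgen_Lsubgroup theta : Lsubgroup (Lgen theta).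
Proof.
split=> [x y|x].
  apply: (LinfP _).2 => _ [nu [nuS le_nu] <-].
  have /lefP le_gen := Lgen_min nuS le_nu.
  by apply: le_trans (nuS.1 x y); apply: leI2.
congr Linf; apply/seteqP; split=> _ [nu [nuS le_nu] <-].
  by exists nu; rewrite // nuS.2.
by exists nu; rewrite // nuS.2.
Qed.

End Complete.
End LSubgroups.

(* Main.v *)
(* Put nu = <eta, eta^{a_x}>, so nu = eta or nu = mu by maximality. If nu = mu,
   the L-point a_x itself lies in nu. If nu = eta, then eta^{a_x} <= eta, and the
   point (a /\ eta(1))_1 works once the reverse inequality
   a /\ eta(z) <= eta(x z x^-1) is known. For this, apply maximality to the
   L-subgroup theta(z) = mu(z) /\ (a => eta(x^-1 z x)), where => is the Heyting
   implication of L: both theta = eta and theta = mu give that inequality. *)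
Require Import Defs.
From mathcomp Require Import all_boot all_order all_fingroup.
From mathcomp Require Import boolp classical_sets.

Set Implicit Arguments.
Unset Strict Implicit.
Unset Printing Implicit Defensive.

Import Order.TTheory.

Local Open Scope classical_set_scope.
Local Open Scope order_scope.

Section HeytingImplication.
Variables (d : Order.disp_t) (L : tbLatticeType d).
Hypotheses (cL : complete_lattice L) (cdL : completely_distributive L).

(** Complete distributivity for the two sets {a} and [S]: a choice function picks [a] and some c in
    [S], so the infimum of its values is below a /\ c. *)
Lemma meet_Lsup_le (a b : L) (S : set L) :
  (forall c, S c -> a `&` c <= b) -> a `&` Lsup S <= b.
Proof.
move=> Sb; pose J (i : bool) : set L := if i then [set a] else S.
apply: (@le_trans _ _ (Linf (range (fun i => Lsup (J i))))).
  apply: (LinfP cL _).2 => _ [[] _ <-] /=; last exact: leIr.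
  by apply: leIxl; apply: (LsupP cL _).1.
rewrite cdL; apply: (LsupP cL _).2 => _ [f Jf <-].
have /= fa := Jf true; have /= fS := Jf false.
apply: le_trans (Sb _ fS); rewrite lexI -fa.
by apply/andP; split; apply: (LinfP cL _).1; [exists true|exists false].
Qed.

Definition Limp (a b : L) : L := Lsup [set c | a `&` c <= b].

Lemma le_Limp (a b c : L) : (c <= Limp a b) = (a `&` c <= b).
Proof.
apply/idP/idP => [cab|]; last exact: (LsupP cL _).1.
by apply: le_trans (leI2 (lexx a) cab) _; apply: meet_Lsup_le.
Qed.

End HeytingImplication.

Section ConjugateImplication.
Variables (d : Order.disp_t) (L : tbLatticeType d) (G : groupType).
Hypotheses (cL : complete_lattice L) (cdL : completely_distributive L).
Variables (mu eta : G -> L) (a : L) (x : G).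
Hypotheses (muS : Lsubgroup mu) (etaS : Lsubgroup_of mu eta).

(** Closure under products follows from a /\ (a => u) <= u, used for both factors. *)
Lemma meet_Limp_conj_Lsubgroup_of :
  Lsubgroup_of mu (fun z => mu z `&` Limp a (eta (x^-1 * z * x)%g)).
Proof.
have [[etaM etaV] _] := etaS; split; last by apply/lefP => z; exact: leIl.
split=> [y z|y]; last first.
  by rewrite muS.2 -[in RHS]etaV !invgM invgK mulgA.
rewrite meetACA; apply: leI2; first exact: muS.1.
have -> : (x^-1 * (y * z) * x = (x^-1 * y * x) * (x^-1 * z * x))%g.
  by rewrite !mulgA mulgK.
rewrite le_Limp //; apply: le_trans (etaM _ _).
by rewrite lexI -2!(le_Limp cL cdL a) leIl leIr.
Qed.

Lemma maximal_Lconj_stable :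
    maximal_Lsubgroup mu eta -> Lpoint_in a x mu -> Lconj eta a x <= eta ->
  forall z, a `&` eta z <= eta (x * z * x^-1)%g.
Proof.
move=> [_ etamax] ax /lefP conj_le z.
have /lefP eta_mu := etaS.2.
have axV : Lpoint_in a x^-1%g mu by rewrite /Lpoint_in muS.2.
(* [mu] contains its own conjugate by the [L]-point of value [a] at x^-1. *)
have /lefP mu_conj : Lconj mu a x^-1%g <= mu.
  by apply: (Lconj_Lsubgroup_of muS _ axV).2; split.
have mu_conjx y : a `&` mu y <= mu (x * y * x^-1)%g.
  have := mu_conj (x * y * x^-1)%g.
  by rewrite /Lconj invgK !mulgA mulgKV mulVg mul1g.
have conjK y : (x^-1 * (x * y * x^-1) * x = y)%g.
  by rewrite !mulgA mulgKV mulVg mul1g.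
have := etamax _ meet_Limp_conj_Lsubgroup_of; case.
(* For eta <= theta, read [conj_le] at x^-1 y x: a /\ eta(y) <= eta(x^-1 y x). *)
- apply/lefP => y; rewrite lexI eta_mu le_Limp //.
  have := conj_le (x^-1 * y * x)%g.
  by rewrite /Lconj !mulgA mulgV mul1g mulgK.
(* If theta = eta, evaluate at x z x^-1, where the implication becomes a => eta(z). *)
- move/(congr1 (fun f => f (x * z * x^-1)%g)); rewrite /= conjK => <-.
  rewrite lexI; apply/andP; split.
    by apply: le_trans (mu_conjx _); apply: leI2.
  by rewrite le_Limp // leIxr // leIr.
(* If theta = mu, then a /\ mu is bounded by the conjugate of eta at every
   point; it is applied at x (x z x^-1) x^-1 because a /\ mu is invariant
   under conjugation by x. *)
move/(congr1 (fun f => f (x * (x * z * x^-1) * x^-1)%g)).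
rewrite /= conjK => /meet_idPl; rewrite le_Limp // => mu_le.
apply: le_trans mu_le; rewrite lexI leIl /=.
apply: le_trans (mu_conjx _); rewrite lexI leIl /=.
by apply: le_trans (mu_conjx _); apply: leI2.
Qed.

End ConjugateImplication.

Theorem theorem4p10 (d : Order.disp_t) (L : tbLatticeType d) (G : groupType)
    (mu eta : G -> L) :
  complete_lattice L -> completely_distributive L ->
  Lsubgroup mu -> maximal_Lsubgroup mu eta ->
  pronormal mu eta.
Proof.
move=> cL cdL muS etamax; have [[etaS _ _] max] := etamax.
split=> // a x ax; set theta := eta `|` _.
have theta_gen : theta <= Lgen theta by exact: Lgen_sub.
have eta_gen : eta <= Lgen theta by apply: le_trans theta_gen; exact: leUl.
have conj_gen : Lconj eta a x <= Lgen theta.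
  by apply: le_trans theta_gen; exact: leUr.
have genS : Lsubgroup_of mu (Lgen theta).
  split; first exact: Lgen_Lsubgroup.
  apply: Lgen_min => //; rewrite leUx etaS.2.
  exact: (Lconj_Lsubgroup_of muS etaS ax).2.
have [gen_eta|gen_mu] := max _ genS eta_gen; last first.
  by exists a, x; rewrite gen_mu.
have conj_le : Lconj eta a x <= eta by rewrite -[leRHS]gen_eta.
have stable := maximal_Lconj_stable cL cdL muS etaS etamax ax conj_le.
have eta1 z : eta z <= eta 1%g.
  by rewrite -(mulgV z); apply: le_trans (etaS.1.1 _ _); rewrite etaS.1.2 meetxx.
exists (a `&` eta 1%g), 1%g; split.
  by rewrite /Lpoint_in gen_eta; exact: leIr.
(* As [eta] is largest at 1, its conjugate by the chosen point is a /\ eta(z). *)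
apply/funext => z; rewrite /Lconj mul1g invg1 mulg1 -meetA (meet_idPr (eta1 z)).
apply/le_anti; rewrite !lexI !leIl stable /=.
by have /lefP := conj_le; exact.
Qed.
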